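(* Let $f\colon \mathcal{H}\to\mathbb{R}$ be a DC function, let $D f = [\underline{d} f, \overline{d} f]$ be any global codifferential of $f$, and let $x_* \in \mathcal{H}$ be a given point. Suppose that $f$ is bounded below, and a set $C \subseteq \overline{d} f(x_* )$ is such that $\overline{d} f(x_* ) = \operatorname{cl}\operatorname{co} C$ (in particular, if $f = g - h$, then one can set $C = \{ (h^*(v) + h(x_* ) - \langle v, x_* \rangle, -v) \mid v \in \operatorname{dom} h^* \}$). Then $x_*$ is a globally optimal solution of the problem $\min_{x \in \mathcal{H}} f(x)$ if and only if for any $z \in C$ one has $a(z) \ge 0$, where $(a(z), v(z))$ is a globally optimal solution of the problem $$\min_{(a, v) \in \mathbb{R} \times \mathcal{H}} \| (a, v) \|^2 \quad \text{subject to} \quad (a, v) \in \underline{d} f(x_* ) + z.$$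
   Context: $\mathcal{H}$ is a real Hilbert space with inner product $\langle\cdot,\cdot\rangle$; $\mathbb{R}\times\mathcal{H}$ carries the norm $\|(a,v)\| = \sqrt{a^2+\|v\|^2}$. $\operatorname{cl}$ and $\operatorname{co}$ denote closure and convex hull. ''Closed'' convex function means lower semicontinuous. $h^*(v)=\sup_{x\in\mathcal{H}}(\langle v,x\rangle-h(x))$ is the Fenchel conjugate of $h$, and $\operatorname{dom} h^*$ is its effective domain. An affine support set of a proper closed convex function $g\colon\mathcal{H}\to\mathbb{R}\cup\{\pm\infty\}$ is any closed convex set $S_g\subset\mathbb{R}\times\mathcal{H}$ such that $g(x)=\sup_{(a,v)\in S_g}(a+\langle v,x\rangle)$ for all $x\in\mathcal{H}$. A DC function is a finite-valued $f\colon\mathcal{H}\to\mathbb{R}$ of the form $f=g-h$ with $g,h\colon\mathcal{H}\to\mathbb{R}$ closed convex functions. Given such a decomposition and any affine support sets $S_g$, $S_h$ of $g$, $h$, set for $x\in\mathcal{H}$ $$\underline{d} f(x) = \{ (a - g(x) + \langle v, x \rangle, v) \mid (a, v) \in S_g \},\quad \overline{d} f(x) = \{ (- b + h(x) - \langle w, x \rangle, - w) \mid (b, w) \in S_h \}.$$ The pair $Df=[\underline{d} f,\overline{d} f]$ of set-valued maps is called a global codifferential (mapping) of $f$ associated with the DC decomposition $f=g-h$; a global codifferential of $f$ is any pair obtained in this way.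
   Formalization: The remark that one can set C = {(h*(v)+h(x_* )-⟨v,x_*⟩,-v)} fails for some S_h (h=|x|, S_h={b≤0}×[-1,1]); it is proved that cl co C is the hyperdifferential at x_* for some affine support set of the same h, and that the criterion holds with this C for the given Df. *)

(* Defs.v *)
From HB Require Import structures.
From mathcomp Require Import all_boot all_order all_algebra.
From mathcomp Require Import sesquilinear.
From mathcomp Require Import all_classical all_reals all_analysis.

Set Implicit Arguments.
Unset Strict Implicit.
Unset Printing Implicit Defensive.

Import Order.TTheory GRing.Theory Num.Theory.
Import numFieldNormedType.Exports.

Local Open Scope classical_set_scope.
Local Open Scope ring_scope.

(* A real Hilbert space is a complete normed module H over R together with a
   dot product ip on H inducing its norm, i.e. ip x x = `|x| ^+ 2. The library's
   norm on the product R^o * H is the max norm; it gives the right topology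
   (closure, closedness), but the norm sqrt(a^2 + |v|^2) has to be defined. *)

Definition is_global_min (R : realType) (T : Type) (F : T -> R) (A : set T)
    (x : T) : Prop :=
  A x /\ forall y, A y -> F x <= F y.

Definition cl_co (R : realType) (V : normedModType R) (A : set V) : set V :=
  closure (smallest (@convex_set R V) A).

Section Codifferential.
Variables (R : realType) (H : completeNormedModType R).
Variable ip : {dot H for @idfun R}.

Definition hilbert_norm (p : R^o * H) : R :=
  Num.sqrt (p.1 ^+ 2 + `|p.2| ^+ 2).

Definition closed_convex_fun (g : H -> R) : Prop :=
  lower_semicontinuous (EFin \o g) /\ convex_function setT g.

Definition dc_decomposition (f g h : H -> R) : Prop :=
  [/\ closed_convex_fun g, closed_convex_fun h & forall x, f x = g x - h x].

Definition is_dc (f : H -> R) : Prop :=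
  exists g h, dc_decomposition f g h.

Definition fenchel_conj (h : H -> \bar R) (v : H) : \bar R :=
  ereal_sup (range (fun x => ((ip v x)%:E - h x)%E)).

Definition edom (h : H -> \bar R) : set H := [set v | (h v < +oo)%E].

Definition affine_support_set (g : H -> \bar R) (S : set (R^o * H)) : Prop :=
  [/\ closed S, convex_set S &
      forall x, g x = ereal_sup [set (p.1 + ip p.2 x)%:E | p in S]].

Definition hypodiff (g : H -> R) (S : set (R^o * H)) (x : H) :
    set (R^o * H) :=
  [set (p.1 - g x + ip p.2 x, p.2) | p in S].

Definition hyperdiff (h : H -> R) (S : set (R^o * H)) (x : H) :
    set (R^o * H) :=
  [set (- p.1 + h x - ip p.2 x, - p.2) | p in S].

Definition codifferential_of (f g h : H -> R)
    (Df : (H -> set (R^o * H)) * (H -> set (R^o * H))) : Prop :=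
  dc_decomposition f g h /\
  exists Sg Sh : set (R^o * H),
    [/\ affine_support_set (EFin \o g) Sg,
        affine_support_set (EFin \o h) Sh &
        Df = (hypodiff g Sg, hyperdiff h Sh)].

Definition global_codifferential (f : H -> R)
    (Df : (H -> set (R^o * H)) * (H -> set (R^o * H))) : Prop :=
  exists g h, codifferential_of f g h Df.

(* [fine] is harmless here: h is real-valued, so its conjugate never takes the
   value -oo, and it is finite at every point of its effective domain. *)
Definition conj_codiff_set (h : H -> R) (x : H) : set (R^o * H) :=
  [set (fine (fenchel_conj (EFin \o h) v) + h x - ip v x, - v)
     | v in edom (fenchel_conj (EFin \o h))].

Definition min_norm_solution (A : set (R^o * H)) (p : R^o * H) : Prop :=
  is_global_min (fun q => hilbert_norm q ^+ 2) A p.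

Definition translate (A : set (R^o * H)) (z : R^o * H) : set (R^o * H) :=
  [set q + z | q in A].

End Codifferential.

(* Main.v *)
(* Write D for the hypodifferential of f = g - h at xs. For z in the
   hyperdifferential let phi_z(d) be the supremum of a + <v, d> over (a, v) in
   D + z, so that f(xs + d) - f(xs) is the infimum of phi_z(d) over z; since
   phi_z(d) is affine and continuous in z, the infimum may be taken over C only,
   and xs is a global minimiser iff phi_z >= 0 for all z in C. Let (a0, v0) be
   the point of least norm of D + z, so that a a0 + <v, v0> >= a0^2 + |v0|^2 on
   D + z. If a0 < 0, dividing by a0 gives phi_z(v0 / a0) < 0. Conversely, phi_z
   is bounded below because f is, hence D + z has points with arbitrarily small
   v; when a0 >= 0 the inequality at these points forces either
   (a0, v0) = (0, 0) in D + z, or a to be asymptotically nonnegative while v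
   tends to 0, and both give phi_z >= 0. *)
Require Import Defs.
From HB Require Import structures.
From mathcomp Require Import all_boot all_order all_algebra.
From mathcomp Require Import sesquilinear ring lra.
From mathcomp Require Import all_classical all_reals all_analysis.

Import Order.TTheory GRing.Theory Num.Theory.
Import numFieldNormedType.Exports.

Local Open Scope classical_set_scope.
Local Open Scope ring_scope.

Lemma closed_preimage (T U : topologicalType) (f : T -> U) (A : set U) :
  continuous f -> closed A -> closed (f @^-1` A).
Proof. by move=> cf; exact: (continuous_closedP f).1 cf A. Qed.

Lemma continuous_pair (T U V : topologicalType) (f : T -> U) (g : T -> V) :
  continuous f -> continuous g -> continuous (fun t => (f t, g t)).
Proof. by move=> cf cg t; exact: (cvg_pair (cf t) (cg t)). Qed.

(** * Convex sets and closed convex hulls *)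

Section convexity.
Context {R : realType} {V : normedModType R}.
Implicit Types A B : set V.

Lemma convex_setP A : convex_set A <->
  forall p q (t : R), 0 <= t <= 1 -> A p -> A q -> A (t *: p + (1 - t) *: q).
Proof.
split=> [cA p q t t01 Ap Aq|cA p q t pA qA].
  have [t0 t1] := andP t01.
  have := cA p q (Itv01 t0 t1) (mem_set Ap) (mem_set Aq).
  by move=> /set_mem.
apply/mem_set/cA; [by apply/andP; split | exact: set_mem | exact: set_mem].
Qed.

Lemma closure_min A B : closed B -> A `<=` B -> closure A `<=` B.
Proof.
move=> cB AB; rewrite (closure_id B).1 //; exact: closureS.
Qed.

(** Two closure arguments, one variable at a time: with one endpoint fixed, the other endpoints
    whose combination lies in [closure A] form a closed set ([B] or [B']). *)
Lemma convex_closure A : convex_set A -> convex_set (closure A).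
Proof.
move=> /convex_setP cA; apply/convex_setP => p q t t01 clp clq.
have cont (r : V) (a b : R) : continuous (fun s : V => a *: s + b *: r).
  by move=> s; apply: cvgD; [apply: cvgZr; exact: cvg_id|exact: cvg_cst].
pose B r := (fun s : V => t *: s + (1 - t) *: r) @^-1` closure A.
pose B' r := (fun s : V => (1 - t) *: s + t *: r) @^-1` closure A.
have closedB r : closed (B r).
  by apply: closed_preimage; [exact: cont|exact: closed_closure].
have closedB' r : closed (B' r).
  by apply: closed_preimage; [exact: cont|exact: closed_closure].
suff : closure A `<=` B' p by move=> /(_ q clq); rewrite /B' /= addrC.
apply: closure_min => // r Ar; rewrite /B' /= addrC.
suff : closure A `<=` B r by move=> /(_ p clp).
apply: closure_min => // s As; apply: subset_closure; exact: cA.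
Qed.

Lemma convex_cl_co A : convex_set (cl_co A).
Proof.
apply: convex_closure; apply/convex_setP => p q t t01 Ap Aq B [cB AB].
by have /convex_setP := cB; apply; [|exact: Ap|exact: Aq].
Qed.

Lemma sub_cl_co A : A `<=` cl_co A.
Proof. by move=> p Ap; apply: subset_closure; exact: sub_gen_smallest. Qed.

Lemma cl_co_min A B : convex_set B -> closed B -> A `<=` B -> cl_co A `<=` B.
Proof.
move=> cB clB AB; apply: closure_min; first exact: clB.
exact: (smallest_sub cB AB).
Qed.

End convexity.

(** * The inner product on the product of the real line and [H] *)

Section projection.
Context {R : realType} {H : completeNormedModType R}.
Variable ip : {dot H for @idfun R}.
Hypothesis ip_norm : forall x : H, ip x x = `|x| ^+ 2.
Implicit Types (x y d : H) (a : R) (p q w z : R^o * H) (K : set (R^o * H)).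

Lemma ipC x y : ip x y = ip y x.
Proof. by rewrite hermC /= expr0 mul1r. Qed.

Lemma ipDl x y d : ip (x + y) d = ip x d + ip y d.
Proof. exact: linearDl. Qed.

Lemma ipDr x y d : ip d (x + y) = ip d x + ip d y.
Proof. exact: linearD. Qed.

Lemma ipZl a x y : ip (a *: x) y = a * ip x y.
Proof. exact: linearZl_LR. Qed.

Lemma ipZr a x y : ip x (a *: y) = a * ip x y.
Proof. by rewrite ipC ipZl ipC. Qed.

Lemma ipNl x y : ip (- x) y = - ip x y.
Proof. exact: linearNl. Qed.

Lemma ipNr x y : ip x (- y) = - ip x y.
Proof. by rewrite ipC ipNl ipC. Qed.

Lemma ip0l x : ip 0 x = 0.
Proof. exact: linear0l. Qed.

Lemma ip0r x : ip x 0 = 0.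
Proof. by rewrite ipC ip0l. Qed.

Definition ipE := (ipDl, ipDr, ipZl, ipZr, ipNl, ipNr, ip0l, ip0r).

(** Expressing [ip] through the norm makes its joint continuity a consequence of that of the
    norm. *)
Lemma ip_polarization x y :
  ip x y = 4^-1 * (`|x + y| ^+ 2 - `|x - y| ^+ 2).
Proof. by rewrite -!ip_norm !ipE (ipC y x); field. Qed.

(** Cauchy-Schwarz, read off from the square of the triangle inequality. *)
Lemma ip_le_norm x y : ip x y <= `|x| * `|y|.
Proof.
have : ip (x + y) (x + y) <= (`|x| + `|y|) ^+ 2.
  by rewrite ip_norm lerXn2r ?nnegrE ?addr_ge0 // ler_normD.
rewrite !ipE (ipC y x) !ip_norm; lra.
Qed.

(** The inner product that induces [hilbert_norm]. *)
Definition ip2 p q : R := p.1 * q.1 + ip p.2 q.2.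

Lemma ip2E p : ip2 p p = (p.1 : R) ^+ 2 + `|p.2| ^+ 2.
Proof. by rewrite /ip2 ip_norm expr2. Qed.

Lemma ip2_ge0 p : 0 <= ip2 p p.
Proof. by rewrite ip2E addr_ge0 ?sqr_ge0. Qed.

Lemma ip2_eq0 p : ip2 p p <= 0 -> p = 0.
Proof.
rewrite ip2E => h.
have p1 : p.1 = 0 :> R.
  by apply/eqP; rewrite -sqrf_eq0 eq_le sqr_ge0 andbT; have := sqr_ge0 `|p.2|; lra.
have p2 : p.2 = 0.
  apply/eqP; rewrite -normr_eq0 -sqrf_eq0 eq_le sqr_ge0 andbT.
  by have := sqr_ge0 (p.1 : R); lra.
by case: p p1 p2 {h} => a b /= -> ->.
Qed.

Lemma ip_continuous (T : topologicalType) (f g : T -> H) :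
  continuous f -> continuous g -> continuous (fun t => ip (f t) (g t) : R^o).
Proof.
move=> cf cg t.
have -> : (fun s => ip (f s) (g s)) =
    (fun s => 4^-1 * (`|f s + g s| ^+ 2 - `|f s - g s| ^+ 2)).
  by apply/funext => s; exact: ip_polarization.
apply: cvgM; first exact: cvg_cst.
apply: cvgB.
  by apply: cvgM; apply: cvg_norm; apply: cvgD; (exact: cf || exact: cg).
by apply: cvgM; apply: cvg_norm; apply: cvgB; (exact: cf || exact: cg).
Qed.

Lemma ip2_continuous (T : topologicalType) (f g : T -> R^o * H) :
  continuous f -> continuous g -> continuous (fun t => ip2 (f t) (g t) : R^o).
Proof.
move=> cf cg t.
have c1 (k : T -> R^o * H) : continuous k -> continuous (fun s => (k s).1).
  by move=> ck s; apply: (cvg_comp _ _ (ck s)); exact: cvg_fst.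
have c2 (k : T -> R^o * H) : continuous k -> continuous (fun s => (k s).2).
  by move=> ck s; apply: (cvg_comp _ _ (ck s)); exact: cvg_snd.
apply: (@cvgD _ R^o).
  by apply: cvgM; exact: c1.
by apply: (ip_continuous _ _ _ _ _ t); exact: c2.
Qed.

Lemma closed_preimage_le (T : topologicalType) (f : T -> R^o) (c : R) :
  continuous f -> closed [set t | f t <= c].
Proof.
move=> cf; exact: (@closed_preimage _ R f [set x : R | x <= c] cf (@closed_le _ c)).
Qed.

Lemma closed_preimage_ge (T : topologicalType) (f : T -> R^o) (c : R) :
  continuous f -> closed [set t | c <= f t].
Proof.
move=> cf; exact: (@closed_preimage _ R f [set x : R | c <= x] cf (@closed_ge _ c)).
Qed.

(** * Projection of the origin onto the closure of a convex set *)

Lemma ip2_sqr_continuous : continuous (fun p => ip2 p p : R^o).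
Proof. by apply: ip2_continuous => p; exact: cvg_id. Qed.

Lemma ip2_norm_lt p (e : R) : 0 < e -> ip2 p p < e ^+ 2 ->
  `|p.1 : R| < e /\ `|p.2| < e.
Proof.
move=> e0; rewrite ip2E -(real_normK (num_real (p.1 : R))) => h.
have := sqr_ge0 `|p.1 : R|; have := sqr_ge0 `|p.2|.
by split; rewrite -(@ltr_pXn2r _ 2%N) ?nnegrE ?(ltW e0) //; lra.
Qed.

(** A minimising sequence is Cauchy by the parallelogram identity; its limit [w] satisfies the
    variational inequality because the norm cannot drop along the segment from [w] to [p]. [K] is
    not assumed closed, since the lemma is also applied to a projected set, which may fail to be
    closed. *)
Lemma projection K : convex_set K -> K !=set0 ->
  exists2 w, closure K w & forall p, K p -> ip2 w w <= ip2 w p.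
Proof.
move=> cK [p0 Kp0].
pose E := [set ip2 p p | p in K].
have hE : has_inf E.
  by split; [exists (ip2 p0 p0), p0 | exists 0 => _ [p _ <-]; exact: ip2_ge0].
have lbK p : K p -> inf E <= ip2 p p.
  by move=> Kp; apply: ge_inf; [exact: hE.2 | exists p].
have /choice[u uP] (n : nat) : exists p, K p /\ ip2 p p < inf E + n.+1%:R^-1.
  have n0 : 0 < n.+1%:R^-1 :> R by rewrite invr_gt0.
  by have [_ [p Kp <-] lt] := inf_adherent n0 hE; exists p.
(* The parallelogram identity in coordinates: [a], [b] are first components, and [x], [y], [z] inner
   products of second components. As the midpoint has squared norm at least [i], the squared
   distance is at most [2 * N + 2 * M]. *)
have midpoint_bound (a b x y z i N M : R) :
    a * a + x < i + N -> b * b + z < i + M -> M <= N ->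
    i <= (2^-1 * a + (1 - 2^-1) * b) * (2^-1 * a + (1 - 2^-1) * b) +
      (2^-1 * (2^-1 * x) + 2^-1 * ((1 - 2^-1) * y) +
       ((1 - 2^-1) * (2^-1 * y) + (1 - 2^-1) * ((1 - 2^-1) * z))) ->
    (a - b) * (a - b) + (x - y + (- y - - z)) <= 4 * N.
  by lra.
have dist (n m : nat) : (n <= m)%N ->
    ip2 (u n - u m) (u n - u m) <= 4 * n.+1%:R^-1.
  move=> nm; have [Kn ltn] := uP n; have [Km ltm] := uP m.
  have mn : m.+1%:R^-1 <= n.+1%:R^-1 :> R by rewrite lef_pV2 ?posrE // ler_nat.
  have h01 : 0 <= 2^-1 :> R /\ 2^-1 <= 1 :> R by split; lra.
  move/andP: h01 => h01.
  have := lbK _ ((convex_setP _).1 cK _ _ _ h01 Kn Km).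
  rewrite /ip2 /= !ipE (ipC (u m).2 (u n).2).
  exact: (midpoint_bound _ _ _ _ _ _ _ _ ltn ltm mn).
have cauchyu (e : R) : 0 < e -> exists n, forall m, (n <= m)%N ->
    `|(u n).1 - (u m).1 : R| < e /\ `|(u n).2 - (u m).2| < e.
  move=> e0; have e2 : 0 < e ^+ 2 / 4 by rewrite divr_gt0 ?exprn_gt0.
  have [n _ nP] := near_infty_natSinv_lt (PosNum e2).
  exists n => m nm; apply: (@ip2_norm_lt (u n - u m)) => //.
  apply: (le_lt_trans (dist _ _ nm)); rewrite mulrC -ltr_pdivlMr //.
  exact: (nP n (leqnn n)).
have cvg1 : cvg ((fun n => (u n).1) @ \oo).
  apply/cauchy_cvgP/cauchy_exP => e e0; have [n nP] := cauchyu e e0.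
  by exists (u n).1; exists n => // m /= nm; exact: (nP m nm).1.
have cvg2 : cvg ((fun n => (u n).2) @ \oo).
  apply/cauchy_cvgP/cauchy_exP => e e0; have [n nP] := cauchyu e e0.
  exists (u n).2; exists n => // m /= nm; rewrite -ball_normE.
  exact: (nP m nm).2.
pose w : R^o * H :=
  (lim ((fun n => (u n).1) @ \oo), lim ((fun n => (u n).2) @ \oo)).
have uw : u @ \oo --> w.
  have -> : u = (fun n => ((u n).1, (u n).2)) by apply/funext => n; case: (u n).
  exact: (cvg_pair cvg1 cvg2).
have clw : closure K w.
  apply: (closed_cvg _ (@closed_closure _ K) _ _ uw).
  by apply: nearW => n; apply: subset_closure; exact: (uP n).1.
have Nw : ip2 w w <= inf E.
  apply/ler_addgt0Pr => e e0.
  have clN := @closed_preimage_le _ _ (inf E + e) ip2_sqr_continuous.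
  apply: (closed_cvg _ clN _ _ uw).
  near=> n => /=; apply: (le_trans (ltW (uP n).2)); rewrite lerD2l; apply: ltW.
  by near: n; exact: (near_infty_natSinv_lt (PosNum e0)).
have lbclK : closure K `<=` [set p | inf E <= ip2 p p].
  apply: closure_min; last exact: lbK.
  exact: (closed_preimage_ge _ _ _ ip2_sqr_continuous).
exists w => // p Kp; rewrite leNgt; apply/negP => lt.
have clp : closure K p by exact: subset_closure.
pose d := ip2 w w - ip2 w p.
have d0 : 0 < d by rewrite subr_gt0.
have D0 := ip2_ge0 (p - w).
pose D := ip2 (p - w) (p - w).
(* Expands the squared norm of [t *: p + (1 - t) *: w] around [w], with the same coding of
   coordinates. *)
have expansion (a b x y z i t : R) :
    i <= (t * a + (1 - t) * b) * (t * a + (1 - t) * b) +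
      (t * (t * x) + t * ((1 - t) * y) +
       ((1 - t) * (t * y) + (1 - t) * ((1 - t) * z))) ->
    b * b + z <= i ->
    0 <= - (t * (b * b + z - (b * a + y))) *+ 2 +
      t ^+ 2 * ((a - b) * (a - b) + (x - y + (- y - - z))).
  by lra.
have key (t : R) : 0 <= t <= 1 -> 0 <= - (t * d) *+ 2 + t ^+ 2 * D.
  move=> t01; have := lbclK _ ((convex_setP _).1 (convex_closure _ cK) _ _ _ t01 clp clw).
  move: Nw; rewrite /d /D /ip2 /= !ipE (ipC p.2 w.2) => Nw lbt.
  exact: (expansion _ _ _ _ _ _ _ lbt Nw).
have {D0}D0 : 0 <= D by [].
have Dd : 0 < D + d by lra.
(* This parameter stays within the segment and makes sense even for [D = 0]. From [t * D <= d] the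
   bound in [key] is at most [- (t * d)], hence negative. *)
have t01 : 0 <= d / (D + d) <= 1.
  by rewrite divr_ge0 ?(ltW d0) ?(ltW Dd) //= ler_pdivrMr //; lra.
have := key _ t01.
have tD : d / (D + d) * D <= d by rewrite mulrAC ler_pdivrMr //; nra.
have t0 : 0 < d / (D + d) by rewrite divr_gt0.
set t := d / (D + d) in t0 tD *.
by rewrite expr2 -mulrA mulr2n => h; nra.
Unshelve. all: by end_near. Qed.

(** * Points of least norm *)

Lemma hilbert_norm_sqr p : hilbert_norm p ^+ 2 = ip2 p p.
Proof. by rewrite /hilbert_norm sqr_sqrtr -ip2E ?ip2_ge0. Qed.

Lemma min_normP K p : min_norm_solution K p <->
  K p /\ forall q, K q -> ip2 p p <= ip2 q q.
Proof.
by split=> -[Kp minp]; split=> // q Kq; have := minp q Kq;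
  rewrite !hilbert_norm_sqr.
Qed.

Lemma ip2B p q : ip2 (p - q) (p - q) = ip2 p p - 2 * ip2 q p + ip2 q q.
Proof.
rewrite /ip2 /= !ipE (ipC p.2 q.2).
have expand (a b x y z : R) : (a - b) * (a - b) + (x - y + (- y - - z)) =
    a * a + x - 2 * (b * a + y) + (b * b + z) by ring.
exact: expand.
Qed.

Lemma ip2_le p q : ip2 q q <= ip2 q p -> ip2 q q <= ip2 p p.
Proof. by have := ip2_ge0 (p - q); rewrite ip2B; lra. Qed.

Lemma ip2_le_eq p q : ip2 p p <= ip2 q q -> ip2 q q <= ip2 q p -> p = q.
Proof.
move=> pq qp; apply/eqP; rewrite -subr_eq0; apply/eqP/ip2_eq0.
by rewrite ip2B; lra.
Qed.

Lemma min_norm_unique K : closed K -> convex_set K -> K !=set0 ->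
  exists! p, min_norm_solution K p.
Proof.
move=> clK cK K0; have [w clw wP] := projection _ cK K0.
rewrite -(closure_id K).1 // in clw.
exists w; split; first by apply/min_normP; split=> // q /wP; exact: ip2_le.
move=> p /min_normP[Kp minp]; apply/esym/ip2_le_eq; first exact: minp.
exact: wP.
Qed.

(** By [ip2_le_eq] any point of least norm is the projection, so it inherits the variational
    inequality. *)
Lemma min_norm_variational K p : closed K -> convex_set K ->
  min_norm_solution K p -> forall q, K q -> ip2 p p <= ip2 p q.
Proof.
move=> clK cK /min_normP[Kp minp].
have [w clw wP] := projection _ cK (ex_intro _ p Kp).
rewrite -(closure_id K).1 // in clw.
by rewrite (ip2_le_eq p w (minp _ clw) (wP _ Kp)).
Qed.

(** * Support functions and the sign of the first component of the point of least norm *)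

Definition support_fun K (phi : H -> R) := forall d c,
  phi d <= c <-> forall p, K p -> p.1 + ip p.2 d <= c.

Lemma support_fun_le K phi : support_fun K phi ->
  forall p d, K p -> p.1 + ip p.2 d <= phi d.
Proof. by move=> sK p d; apply: (sK d (phi d)).1. Qed.

(** Every real bounds an empty family, so an empty [K] would make even [phi 0 - 1] an upper bound of
    [phi 0]. *)
Lemma support_fun_nonempty K phi : support_fun K phi -> K !=set0.
Proof.
move=> sK; apply: contrapT => K0.
have : phi 0 <= phi 0 - 1 by apply/sK => p Kp; case: K0; exists p.
lra.
Qed.

Lemma min_norm_fst_ge0 K phi p : closed K -> convex_set K ->
  support_fun K phi -> (forall d, 0 <= phi d) ->
  min_norm_solution K p -> 0 <= p.1.
Proof.
move=> clK cK sK phi0 minp; rewrite leNgt; apply/negP => p1.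
have varp := min_norm_variational _ _ clK cK minp.
have pos : 0 < ip2 p p.
  by rewrite lt_neqAle ip2_ge0 andbT eq_sym; apply/eqP => h;
    move: p1; rewrite (ip2_eq0 p) ?h //= ltxx.
have neg : ip2 p p / p.1 < 0 by rewrite pmulr_rlt0 // invr_lt0.
(* Multiplying by the negative [p.1] turns the bound for each [q] into the variational inequality at
   [q]. *)
have : phi (p.1^-1 *: p.2) <= ip2 p p / p.1.
  apply/sK => q Kq; rewrite ler_ndivlMr //.
  have := varp q Kq; rewrite {2}/ip2 ipZr (ipC q.2).
  have scal (a b x : R) : a < 0 -> (b + a^-1 * x) * a = a * b + x.
    by move=> a0; field; rewrite lt_eqF.
  by rewrite (scal _ _ _ p1).
by have := phi0 (p.1^-1 *: p.2); lra.
Qed.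

(* If the projection of K to H stayed away from 0, phi would tend to -oo
   along the ray opposite to its point of least norm. *)
Lemma support_fun_small_slope K phi m (e : R) : convex_set K ->
  support_fun K phi -> (forall d, m <= phi d) -> 0 < e ->
  exists2 p, K p & `|p.2| < e.
Proof.
move=> cK sK phim e0; have [p0 Kp0] := support_fun_nonempty _ _ sK.
(* The projection to [H] is kept inside the product, with first component 0, so that [projection]
   applies. *)
pose V := [set (0, p.2) | p in K] : set (R^o * H).
have cV : convex_set V.
  apply/convex_setP => _ _ t t01 [p Kp <-] [q Kq <-].
  exists (t *: p + (1 - t) *: q); first exact: ((convex_setP _).1 cK).
  by congr (_, _); rewrite /= !scaler0 addr0.
have V0 : V !=set0 by exists (0, p0.2), p0.
have [w clw wP] := projection _ cV V0.
have [w0|w0] := leP (ip2 w w) 0.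
  move: clw; rewrite (ip2_eq0 _ w0) => clw.
  have [_ [[p Kp <-] [_]]] := clw _ (nbhsx_ballx _ _ e0).
  by rewrite -ball_normE /= sub0r normrN => pe; exists p.
(* Chosen so that [phi 0 - t * ip2 w w] equals [m - 1], below the lower bound [m]. *)
pose t := (phi 0 - m + 1) / ip2 w w.
have t0 : 0 <= t by rewrite divr_ge0 ?(ltW w0) //; have := phim 0; lra.
have : phi (- t *: w.2) <= phi 0 - t * ip2 w w.
  apply/sK => p Kp; rewrite ipZr.
  have := support_fun_le _ _ sK p 0 Kp; rewrite ip0r addr0 => p1.
  have : ip2 w w <= ip p.2 w.2.
    have := wP (0, p.2); rewrite {2}/ip2 /= mulr0 add0r ipC; apply; by exists p.
  by move=> /(ler_wpM2l t0); rewrite mulNr; apply: lerB.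
by rewrite /t divfK ?gt_eqF //; have := phim (- t *: w.2); rewrite /t; lra.
Qed.

Lemma support_fun_ge0 K phi m p : closed K -> convex_set K ->
  support_fun K phi -> (forall d, m <= phi d) ->
  min_norm_solution K p -> 0 <= p.1 -> forall d, 0 <= phi d.
Proof.
move=> clK cK sK phim minp p1 d.
have varp := min_norm_variational _ _ clK cK minp.
have Kp : K p by case: minp.
have small := fun e => support_fun_small_slope _ _ _ e cK sK phim.
(* If [p.1 = 0], the variational inequality and Cauchy-Schwarz force [|q.2| >= |p.2|] on [K] unless
   [p.2 = 0]; small slopes leave only [p = 0], and a zero in [K] gives [phi >= 0]. *)
have [p10|p1_neq0] := eqVneq (p.1 : R) 0.
  suff p20 : p.2 = 0.
    by have := support_fun_le _ _ sK p d Kp; rewrite p10 p20 ip0l addr0.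
  apply: contrapT => /eqP; rewrite -normr_gt0 => p20.
  have [q Kq q2] := small _ p20.
  have := varp q Kq; rewrite ip2E /ip2 p10 mul0r add0r expr0n add0r => h.
  by have := ip_le_norm p.2 q.2; nra.
have {p1 p1_neq0}p1 : 0 < (p.1 : R) by rewrite lt_neqAle eq_sym p1_neq0.
rewrite leNgt; apply/negP => phid.
(* On [K] the variational inequality yields [p.1 * (q.1 + ip q.2 d) >= - (p.1 * |d| + |p.2|) *
   |q.2|], so a small [|q.2|] contradicts [phi d < 0]. The summand 1 keeps the divisor [C]
   positive. *)
pose C := p.1 * `|d| + `|p.2| + 1.
have C0 : 0 < C by rewrite ltr_wpDl // addr_ge0 // mulr_ge0 // ltW.
have e0 : 0 < p.1 * - phi d / C by rewrite divr_gt0 // mulr_gt0 // oppr_gt0.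
have [q Kq q2] := small _ e0.
have h1 := le_trans (ip2_ge0 p) (varp q Kq).
have h2 := support_fun_le _ _ sK q d Kq.
have h3 := ip_le_norm p.2 q.2.
have h4 := ip_le_norm (- q.2) d.
have C_e : C * `|q.2| < p.1 * - phi d by rewrite mulrC -ltr_pdivlMr.
move: h1 h2 h3 h4 C_e p1 phid (normr_ge0 q.2); rewrite /ip2 ipNl normrN /C.
have contra (a b x y f nd np nq : R) : 0 <= a * b + x -> b + y <= f ->
  x <= np * nq -> - y <= nq * nd -> (a * nd + np + 1) * nq < a * - f ->
  0 < a -> f < 0 -> 0 <= nq -> False by move=> *; nra.
exact: contra.
Qed.

(** * Half-spaces containing a closed convex hull *)

Lemma affine_form_continuous (d : H) :
  continuous (fun p => p.1 + ip p.2 d : R^o).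
Proof.
move=> p; apply: (@cvgD _ R^o); first exact: cvg_fst.
apply: (@ip_continuous _ snd (fun=> d)) => q; [exact: cvg_snd|exact: cvg_cst].
Qed.

Lemma closed_half_space (c : R) (d : H) :
  closed [set p : R^o * H | c <= p.1 + ip p.2 d].
Proof. exact/closed_preimage_ge/affine_form_continuous. Qed.

Lemma convex_half_space (c : R) (d : H) :
  convex_set [set p : R^o * H | c <= p.1 + ip p.2 d].
Proof.
apply/convex_setP => p q t /andP[t0 t1] /= hp hq; rewrite !ipE.
have comb (a b x y : R) : c <= a + x -> c <= b + y ->
    c <= t * a + (1 - t) * b + (t * x + (1 - t) * y) by move=> *; nra.
exact: comb.
Qed.

(** This is how an inequality affine in [z] passes from [C] to the whole hyperdifferential. *)
Lemma cl_co_half_space (C : set (R^o * H)) (c : R) (d : H) :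
  (forall p, C p -> c <= p.1 + ip p.2 d) ->
  forall p, cl_co C p -> c <= p.1 + ip p.2 d.
Proof.
move=> hC.
exact: (cl_co_min C _ (convex_half_space c d) (closed_half_space c d) hC).
Qed.

(** * Affine support sets and the codifferentials they generate *)

Lemma affine_support_setP (g : H -> R) K : affine_support_set ip (EFin \o g) K <->
  [/\ closed K, convex_set K & support_fun K g].
Proof.
split=> -[clK cK sK]; split=> // x.
  move=> c; rewrite -lee_fin (sK x : (g x)%:E = _); split=> [h p Kp|h].
    rewrite -lee_fin; apply: le_trans h.
    by apply: ereal_sup_ubound; exists p.
  by apply: ge_ereal_sup => _ [p Kp <-]; rewrite lee_fin h.
apply/eqP; rewrite eq_le; apply/andP; split; last first.
  apply: ge_ereal_sup => _ [p Kp <-]; rewrite lee_fin.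
  exact: (support_fun_le _ _ sK).
have ub p : K p -> ((p.1 + ip p.2 x)%:E <=
    ereal_sup [set (p.1 + ip p.2 x)%:E | p in K])%E.
  by move=> Kp; apply: ereal_sup_ubound; exists p.
(* The value [-oo] is excluded by a point of [K], which is nonempty. *)
case: (ereal_sup _) ub => [r| |] ub /=.
- by rewrite lee_fin; apply/sK => p /ub; rewrite lee_fin.
- exact: leey.
- by have [p /ub] := support_fun_nonempty _ _ sK.
Qed.

Lemma closed_hypodiff (g : H -> R) K x : closed K -> closed (hypodiff ip g K x).
Proof.
move=> clK.
(* The inverse of the affine map defining [hypodiff]: the image of [K] becomes a preimage under a
   continuous map. *)
pose G p : R^o * H := (p.1 + g x - ip p.2 x, p.2).
have -> : hypodiff ip g K x = G @^-1` K.
  apply/seteqP; split=> [_ [[a v] Kp <-]|[a v] Gp].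
    rewrite /preimage /G /=; congr (K (_, _)) : Kp.
    have arith (b c d : R) : b = b - c + d + c - d by ring.
    exact: arith.
  exists (G (a, v)) => //; congr (_, _).
  have arith (b c d : R) : b + c - d - c + d = b by ring.
  exact: arith.
apply: closed_preimage clK.
apply: continuous_pair => p; last exact: cvg_snd.
apply: (@cvgB _ R^o).
  by apply: (@cvgD _ R^o); [exact: cvg_fst|exact: cvg_cst].
apply: (@ip_continuous _ snd (fun=> x)) => q; [exact: cvg_snd|exact: cvg_cst].
Qed.

Lemma convex_hypodiff (g : H -> R) K x :
  convex_set K -> convex_set (hypodiff ip g K x).
Proof.
move=> /convex_setP cK; apply/convex_setP => _ _ t t01 [p Kp <-] [q Kq <-].
exists (t *: p + (1 - t) *: q); first exact: cK.
congr (_, _); rewrite /= !ipE.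
have comb (a b c y z : R) : t * a + (1 - t) * b - c + (t * y + (1 - t) * z) =
    t * (a - c + y) + (1 - t) * (b - c + z) by ring.
exact: comb.
Qed.

(** The shift in [hypodiff] recentres each affine minorant of [g] at [x] and subtracts [g x]. *)
Lemma support_fun_hypodiff (g : H -> R) K x : support_fun K g ->
  support_fun (hypodiff ip g K x) (fun d => g (x + d) - g x).
Proof.
move=> sK d c; rewrite lerBlDr; split=> [/sK h _ [p Kp <-]|h] /=.
  by have := h p Kp; rewrite ipDr; lra.
apply/sK => p Kp.
have := h (p.1 - g x + ip p.2 x, p.2); rewrite /= ipDr => /(_ (ex_intro2 _ _ p Kp erefl)).
lra.
Qed.

Lemma closed_translate K z : closed K -> closed (translate K z).
Proof.
move=> clK.
have -> : translate K z = (fun p => p - z) @^-1` K.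
  apply/seteqP; split=> [_ [p Kp <-]|p Kp] /=; first by rewrite addrK.
  by exists (p - z) => //; rewrite subrK.
apply: closed_preimage clK.
move=> p.
by apply: cvgB; [exact: cvg_id|exact: cvg_cst].
Qed.

Lemma convex_translate K z : convex_set K -> convex_set (translate K z).
Proof.
move=> /convex_setP cK; apply/convex_setP => _ _ t t01 [p Kp <-] [q Kq <-].
exists (t *: p + (1 - t) *: q); first exact: cK.
rewrite !scalerDr addrACA -scalerDl; congr (_ + _).
by rewrite addrC subrK scale1r.
Qed.

Lemma support_fun_translate K phi z : support_fun K phi ->
  support_fun (translate K z) (fun d => phi d + (z.1 + ip z.2 d)).
Proof.
move=> sK d c; rewrite -lerBrDr; split=> [/sK h _ [p Kp <-]|h] /=.
  have := h p Kp; rewrite ipDl.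
  have arith (a b x y : R) : a + x <= c - (b + y) -> a + b + (x + y) <= c by lra.
  exact: arith.
apply/sK => p Kp.
have := h (p + z) (ex_intro2 _ _ p Kp erefl); rewrite /= ipDl.
have arith (a b x y : R) : a + b + (x + y) <= c -> a + x <= c - (b + y) by lra.
exact: arith.
Qed.

Lemma hyperdiff_ge (h : H -> R) K x z d : support_fun K h ->
  hyperdiff ip h K x z -> h x - h (x + d) <= z.1 + ip z.2 d.
Proof.
move=> sK [p Kp <-] /=; have := support_fun_le _ _ sK p (x + d) Kp.
by rewrite ipDr ipNl; lra.
Qed.

(** * The optimality criterion *)

Section optimality.
Variables (g h : H -> R) (Sg Sh : set (R^o * H)) (x0 : H).
Hypotheses (suppg : affine_support_set ip (EFin \o g) Sg)
  (supph : affine_support_set ip (EFin \o h) Sh).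

Let phi (z : R^o * H) (d : H) := g (x0 + d) - g x0 + (z.1 + ip z.2 d).

Lemma translate_hypodiff_convex z :
  let K := translate (hypodiff ip g Sg x0) z in
  [/\ closed K, convex_set K & support_fun K (phi z)].
Proof.
have [clS cS sS] := (affine_support_setP _ _).1 suppg; split.
- exact/closed_translate/closed_hypodiff.
- exact/convex_translate/convex_hypodiff.
- exact/support_fun_translate/support_fun_hypodiff.
Qed.

Lemma translate_hypodiff_min_norm_unique z :
  exists! p, min_norm_solution (translate (hypodiff ip g Sg x0) z) p.
Proof.
have [clK cK sK] := translate_hypodiff_convex z.
exact: min_norm_unique (support_fun_nonempty _ _ sK).
Qed.

Lemma global_min_min_norm (f : H -> R) (C : set (R^o * H)) :
  (forall x, f x = g x - h x) -> has_lbound (range f) ->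
  C `<=` hyperdiff ip h Sh x0 -> hyperdiff ip h Sh x0 = cl_co C ->
  is_global_min f setT x0 <->
  forall z, C z -> forall p,
    min_norm_solution (translate (hypodiff ip g Sg x0) z) p -> 0 <= p.1.
Proof.
move=> fE [m lbm] CE EC; have [_ _ sSh] := (affine_support_setP _ _).1 supph.
have phi_ge z d : C z -> f (x0 + d) - f x0 <= phi z d.
  by move=> /CE/(hyperdiff_ge _ _ _ _ d sSh); rewrite !fE /phi; lra.
split=> [[_ minf] z Cz p|nonneg].
  have [clK cK sK] := translate_hypodiff_convex z.
  apply: (min_norm_fst_ge0 _ _ _ clK cK sK) => d.
  by apply: le_trans (phi_ge z d Cz); rewrite subr_ge0; exact: minf.
split=> // y _; rewrite !fE.
(* The inequality [f x0 <= f y] is read as an upper bound on [h y], so it can be checked on each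
   affine minorant from [Sh]. *)
suff : h y <= h x0 + g y - g x0 by lra.
apply/sSh => p Shp.
(* The minorant [p] gives a point of the hyperdifferential, that is of [cl_co C]; on [C] itself the
   inequality says that [phi z (y - x0)] is nonnegative. *)
have : g x0 - g y <= (- p.1 + h x0 - ip p.2 x0) + ip (- p.2) (y - x0).
  apply: (cl_co_half_space C _ (y - x0)) (- p.1 + h x0 - ip p.2 x0, - p.2) _;
    last by rewrite -EC; exists p.
  move=> z Cz; have [clK cK sK] := translate_hypodiff_convex z.
  have [w [minw _]] := translate_hypodiff_min_norm_unique z.
  have lb d : m - f x0 <= phi z d.
    apply: le_trans (phi_ge z d Cz); rewrite lerD2r; apply: lbm.
    by exists (x0 + d).
  have := support_fun_ge0 _ _ _ _ clK cK sK lb minw (nonneg z Cz w minw) (y - x0).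
  rewrite /phi subrKC; lra.
by rewrite !ipE; lra.
Qed.

(** * The hyperdifferential generated by the conjugate *)

Lemma fenchel_conj_edomP v : edom (fenchel_conj ip (EFin \o h)) v <->
  fenchel_conj ip (EFin \o h) v = (fine (fenchel_conj ip (EFin \o h) v))%:E.
Proof.
split=> [|vE]; last by rewrite /edom /= vE ltry.
(* The term at 0 keeps the conjugate above [-oo]. *)
rewrite /edom /=; have : ((ip v 0 - h 0)%:E <= fenchel_conj ip (EFin \o h) v)%E.
  by apply: ereal_sup_ubound; exists 0.
by case: (fenchel_conj _ _ _).
Qed.

Lemma fenchel_conj_le v (c : R) : (fenchel_conj ip (EFin \o h) v <= c%:E)%E <->
  forall x, ip v x - h x <= c.
Proof.
split=> [le_c x|le_c].
  rewrite -lee_fin; apply: le_trans le_c.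
  by apply: ereal_sup_ubound; exists x.
by apply: ge_ereal_sup => _ [x _ <-]; rewrite lee_fin.
Qed.

(* The inequality h <= h** needs no separation theorem here: every (b, w) in Sh
   satisfies b <= - h*(w). *)
Lemma conj_codiff_support_set : exists2 S,
  affine_support_set ip (EFin \o h) S &
  hyperdiff ip h S x0 = cl_co (conj_codiff_set ip h x0).
Proof.
have [_ _ sSh] := (affine_support_setP _ _).1 supph.
set C := conj_codiff_set ip h x0.
(* [F] is the map defining [hyperdiff] and [G] a right inverse, so the preimage of [cl_co C] under
   [F] has [cl_co C] as its hyperdifferential. *)
pose F p : R^o * H := (- p.1 + h x0 - ip p.2 x0, - p.2).
pose G p : R^o * H := (- p.1 + h x0 + ip p.2 x0, - p.2).
have GK p : F (G p) = p.
  case: p => a v; rewrite /F /G /= opprK ipNl; congr (_, _).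
  have arith (b c d : R) : - (- b + c + d) + c - - d = b by ring.
  exact: arith.
exists (F @^-1` cl_co C); last first.
  apply/seteqP; split=> [_ [p Sp <-]//|p Cp].
  by exists (G p); [rewrite /= GK|exact: GK].
apply/affine_support_setP; split.
- apply: closed_preimage; last exact: closed_closure.
  apply: continuous_pair => p; last by apply: cvgN; exact: cvg_snd.
  apply: (@cvgB _ R^o).
    apply: (@cvgD _ R^o); last exact: cvg_cst.
    by apply: (@cvgN _ R^o); exact: cvg_fst.
  by apply: (@ip_continuous _ snd (fun=> x0)) => q; [exact: cvg_snd|exact: cvg_cst].
- have /convex_setP cC := convex_cl_co C.
  apply/convex_setP => p q t t01 Sp Sq; have := cC _ _ _ t01 Sp Sq.
  rewrite /preimage /=; congr (cl_co C _); congr (_, _); last first.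
    by rewrite /= !scalerN opprD.
  rewrite /= !ipE.
  have comb (a b c y z : R) :
     t * (- a + c - y) + (1 - t) * (- b + c - z) =
     - (t * a + (1 - t) * b) + c - (t * y + (1 - t) * z) by ring.
  exact: comb.
- move=> x c; split=> [hx p Sp|hx].
    apply: le_trans hx.
    (* On [C] this is the Fenchel-Young inequality, which then extends to [cl_co C]. *)
    have : h x0 - h x <= (F p).1 + ip (F p).2 (x - x0).
      apply: cl_co_half_space Sp => _ [v /fenchel_conj_edomP vfin <-] /=.
      have FY : ip v x - h x <= fine (fenchel_conj ip (EFin \o h) v).
        by move: x; apply/fenchel_conj_le; rewrite -vfin.
      rewrite !ipE; lra.
    by rewrite /F /= ipNl !ipE; lra.
  apply/sSh => p Shp.
  (* Since [p] minorises [h], the pair [(- r, p.2)], with [r] the conjugate at [p.2], dominates [p];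
     this pair belongs to the new support set. *)
  have conj_le : (fenchel_conj ip (EFin \o h) p.2 <= (- p.1)%:E)%E.
    apply/fenchel_conj_le => y.
    by have := support_fun_le _ _ sSh p y Shp; lra.
  have vdom : edom (fenchel_conj ip (EFin \o h)) p.2.
    by apply: le_lt_trans conj_le _; rewrite ltry.
  set r := fine (fenchel_conj ip (EFin \o h) p.2).
  have rE : fenchel_conj ip (EFin \o h) p.2 = r%:E by exact/fenchel_conj_edomP.
  have rp : r <= - p.1 by rewrite -lee_fin -rE.
  have := hx (- r, p.2); rewrite /preimage /F /= opprK.
  have : C (r + h x0 - ip p.2 x0, - p.2) by exists p.2.
  by move=> /(@sub_cl_co _ _ C) Cp /(_ Cp); lra.
Qed.

End optimality.

End projection.

Theorem theorem1 (R : realType) (H : completeNormedModType R)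
    (ip : {dot H for @idfun R}) (ip_norm : forall x : H, ip x x = `|x| ^+ 2)
    (f : H -> R) (f_dc : is_dc f)
    (Df : (H -> set (R^o * H)) * (H -> set (R^o * H)))
    (Df_codiff : global_codifferential ip f Df)
    (xs : H) (f_bounded_below : has_lbound (range f)) :
  (forall C : set (R^o * H),
     C `<=` Df.2 xs -> Df.2 xs = cl_co C ->
     (forall z, C z ->
        exists! p, min_norm_solution (translate (Df.1 xs) z) p) /\
     (is_global_min f setT xs <->
      forall z, C z ->
        forall p, min_norm_solution (translate (Df.1 xs) z) p -> 0 <= p.1)) /\
  (forall g h : H -> R, codifferential_of ip f g h Df ->
     (exists dbar : H -> set (R^o * H),
        [/\ codifferential_of ip f g h (Df.1, dbar),
            conj_codiff_set ip h xs `<=` dbar xs &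
            dbar xs = cl_co (conj_codiff_set ip h xs)]) /\
     (forall z, conj_codiff_set ip h xs z ->
        exists! p, min_norm_solution (translate (Df.1 xs) z) p) /\
     (is_global_min f setT xs <->
      forall z, conj_codiff_set ip h xs z ->
        forall p, min_norm_solution (translate (Df.1 xs) z) p -> 0 <= p.1)).
Proof.
split.
  move=> C CE EC.
  have [g [h [[_ _ fE] [Sg [Sh [suppg supph DfE]]]]]] := Df_codiff.
  subst Df; split.
    move=> z _; exact: (translate_hypodiff_min_norm_unique ip ip_norm g Sg).
  exact: (global_min_min_norm ip ip_norm g h Sg Sh xs suppg supph f C).
(* The given [Sh] may produce another hyperdifferential than the closed convex hull of the conjugate
   set; it is replaced by [S], with [g], [h] and the hypodifferential unchanged. *)
move=> g h [dc [Sg [Sh [suppg supph DfE]]]]; have [_ _ fE] := dc.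
have [S suppS hyperS] := conj_codiff_support_set ip ip_norm h Sh xs supph.
have sub : conj_codiff_set ip h xs `<=` hyperdiff ip h S xs.
  by rewrite hyperS; exact: sub_cl_co.
subst Df; split; last split.
- exists (hyperdiff ip h S); split=> //; split=> //.
  by exists Sg, S.
- move=> z _; exact: (translate_hypodiff_min_norm_unique ip ip_norm g Sg).
- exact: (global_min_min_norm ip ip_norm g h Sg S xs suppg suppS f).
Qed.
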